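(* Let $q\in\mathbf{C}^\times$, and let $L$, $\Lambda$ and $H$ be the Lefschetz operator, dual Lefschetz operator and counting operator on the differential forms $\Omega^\bullet_q(S^2)$ of the standard Podleś sphere. Then $$[H,L]=2L,\qquad [H,\Lambda]=-2\Lambda,\qquad [L,\Lambda]=H,$$ and hence the operators $L,\Lambda,H$ define a representation of $\mathfrak{sl}_2$.
   Context: Algebra. $q\in\mathbf{C}^\times$. $\mathbf{C}_q[SU_2]$ is the Hopf $*$-algebra generated by $a,b,c,d$ with $ab=qba$, $ac=qca$, $bd=qdb$, $cd=qdc$, $bc=cb$, $ad-da=(q-q^{-1})bc$, $ad-qbc=1$. It is $\mathbf{Z}$-graded by $\deg a=\deg c=-1$, $\deg b=\deg d=1$; $\mathcal{E}_k$ is the degree-$k$ part, and the Podleś sphere is $\mathbf{C}_q[S^2]=\mathcal{E}_0$. Forms. The graded algebra of forms is $\Omega^\bullet_q(S^2)=\Omega^0\oplus\Omega^1\oplus\Omega^2$ with $\Omega^0=\mathcal{E}_0$, $\Omega^1=\mathcal{E}_2e^+\oplus\mathcal{E}_{-2}e^-$, $\Omega^2=\mathcal{E}_0\tau$, where $e^+,e^-,\tau$ are basis elements (the classes of $\mathrm{d}b_+$, $\mathrm{d}b_-$, $\mathrm{d}b_+\wedge \mathrm{d}b_-$ with $b_+=cd$, $b_-=ab$). For $f,f'\in\mathcal{E}_2$, $g,g'\in\mathcal{E}_{-2}$: $(fe^+)\wedge(ge^-)=fg\,\tau$, $(ge^-)\wedge(fe^+)=-q^2gf\,\tau$, $(fe^+)\wedge(f'e^+)=0=(ge^-)\wedge(g'e^-)$;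 products of total degree $>2$ vanish. Operators. The Hodge map is given by $\ast_H(m)=m\tau$, $\ast_H(m\tau)=m$, $\ast_H(fe^+)=i\,fe^+$, $\ast_H(ge^-)=-i\,ge^-$ ($m\in\mathcal{E}_0$, $f\in\mathcal{E}_2$, $g\in\mathcal{E}_{-2}$). The fundamental form is $\kappa=-e^+\wedge e^-=-\tau$; the Lefschetz operator is $L(\omega)=\omega\wedge\kappa$; the dual Lefschetz operator is $\Lambda=\ast_H^{-1}\circ L\circ\ast_H$; the counting operator is $H=\sum_{k=0}^2(k-1)\Pi^k$ with $\Pi^k$ the projection of $\Omega^\bullet_q(S^2)$ onto $\Omega^k$. $[A,B]=AB-BA$. *)

(* Defs.v *)
From HB Require Import structures.
From mathcomp Require Import all_boot all_order all_algebra.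
From mathcomp Require Import boolp functions reals.
From mathcomp Require Import complex.
From mathcomp Require Import finmap monalg.

Set Implicit Arguments.
Unset Strict Implicit.
Unset Printing Implicit Defensive.

Import GRing.Theory Num.Theory.

Local Open Scope ring_scope.
Local Open Scope quotient_scope.

(* ** Two-sided ideals and quotient algebras *)

Section IdealGeneratedBy.
Variables (A : nzRingType) (S : seq A).

Definition gen_ideal_pred (x : A) : bool :=
  `[< exists2 s : seq (A * A * A), all (fun t => t.1.2 \in S) s &
        x = \sum_(t <- s) t.1.1 * t.1.2 * t.2 >].
Definition gen_ideal : {pred A} := gen_ideal_pred.

Lemma gen_idealP (x : A) : reflect
  (exists2 s : seq (A * A * A), all (fun t => t.1.2 \in S) s &
        x = \sum_(t <- s) t.1.1 * t.1.2 * t.2) (x \in gen_ideal).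
Proof. exact: asboolP. Qed.

Lemma gen_idealMl u x : x \in gen_ideal -> u * x \in gen_ideal.
Proof.
move=> /gen_idealP[s hs ->]; apply/gen_idealP.
exists [seq (u * t.1.1, t.1.2, t.2) | t <- s]; first by rewrite all_map.
by rewrite big_map mulr_sumr; apply: eq_bigr => t _; rewrite !mulrA.
Qed.

Lemma gen_idealMr u x : x \in gen_ideal -> x * u \in gen_ideal.
Proof.
move=> /gen_idealP[s hs ->]; apply/gen_idealP.
exists [seq (t.1.1, t.1.2, t.2 * u) | t <- s]; first by rewrite all_map.
by rewrite big_map mulr_suml; apply: eq_bigr => t _; rewrite !mulrA.
Qed.

Lemma gen_ideal_zmod_closed : zmod_closed gen_ideal.
Proof.
split=> [|x y /gen_idealP[s hs ->]].
  by apply/gen_idealP; exists [::]; rewrite ?big_nil.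
move=> /(gen_idealMl (-1)) /gen_idealP[t ht]; rewrite mulN1r => ->.
by apply/gen_idealP; exists (s ++ t); rewrite ?all_cat ?hs // big_cat.
Qed.

Lemma gen_ideal_morph0 (B : nzRingType) (f : {rmorphism A -> B}) :
  (forall x, x \in S -> f x = 0) -> forall x, x \in gen_ideal -> f x = 0.
Proof.
move=> fS x /gen_idealP[s /allP hs ->]; rewrite rmorph_sum big_seq big1 // => t.
by move=> /hs /fS; rewrite !rmorphM /= => ->; rewrite mulr0 mul0r.
Qed.

End IdealGeneratedBy.

Record ideal2 (A : nzRingType) := Ideal2 {
  ideal2_pred : {pred A};
  ideal2_zmod_closed : zmod_closed ideal2_pred;
  ideal2_1 : 1 \notin ideal2_pred;
  ideal2Ml : forall u x, x \in ideal2_pred -> u * x \in ideal2_pred;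
  ideal2Mr : forall u x, x \in ideal2_pred -> x * u \in ideal2_pred }.

HB.instance Definition _ (A : nzRingType) (I : ideal2 A) :=
  GRing.isZmodClosed.Build A (ideal2_pred I) (ideal2_zmod_closed I).

Section QuotientAlgebra.
Variables (K : comNzRingType) (A : algType K) (I : ideal2 A).

Definition quot_alg : Type := {ideal_quot ideal2_pred I}.
HB.instance Definition _ := GRing.Zmodule.on quot_alg.

Definition quot_cls (x : A) : quot_alg := \pi_({ideal_quot ideal2_pred I}) x.
Definition quot_repr (x : quot_alg) : A := repr (x : {ideal_quot ideal2_pred I}).

Lemma quot_reprK x : quot_cls (quot_repr x) = x.
Proof. exact: reprK. Qed.

Lemma quot_clsP x y : reflect (quot_cls x = quot_cls y) (x - y \in ideal2_pred I).
Proof. by rewrite Quotient.idealrBE; exact: eqP. Qed.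

Lemma quot_clsD : {morph quot_cls : x y / x + y}.
Proof. by move=> x y; rewrite /quot_cls raddfD. Qed.

Definition quot_one : quot_alg := quot_cls 1.
Definition quot_mul (x y : quot_alg) := quot_cls (quot_repr x * quot_repr y).
Definition quot_scale (k : K) (x : quot_alg) := quot_cls (k *: quot_repr x).

Lemma quot_clsM x y : quot_cls (x * y) = quot_mul (quot_cls x) (quot_cls y).
Proof.
apply/quot_clsP; set x' := quot_repr _; set y' := quot_repr _.
have hx : x - x' \in ideal2_pred I by apply/quot_clsP; rewrite quot_reprK.
have hy : y - y' \in ideal2_pred I by apply/quot_clsP; rewrite quot_reprK.
rewrite -[x * y](subrK (x' * y)) -mulrBl -addrA -mulrBr.
by apply: rpredD; [exact: ideal2Mr | exact: ideal2Ml].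
Qed.

Lemma quot_clsZ k x : quot_cls (k *: x) = quot_scale k (quot_cls x).
Proof.
apply/quot_clsP; rewrite -scalerBr -[_ - _]mul1r scalerAl.
by apply: ideal2Ml; apply/quot_clsP; rewrite quot_reprK.
Qed.

Lemma quot_mulA : associative quot_mul.
Proof.
move=> x y z; rewrite -[x]quot_reprK -[y]quot_reprK -[z]quot_reprK.
by rewrite -!quot_clsM mulrA.
Qed.

Lemma quot_mul1x : left_id quot_one quot_mul.
Proof. by move=> x; rewrite -[x]quot_reprK -quot_clsM mul1r. Qed.

Lemma quot_mulx1 : right_id quot_one quot_mul.
Proof. by move=> x; rewrite -[x]quot_reprK -quot_clsM mulr1. Qed.

Lemma quot_mulDl : left_distributive quot_mul +%R.
Proof.
move=> x y z; rewrite -[x]quot_reprK -[y]quot_reprK -[z]quot_reprK.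
by rewrite -[X in quot_mul X _ = _]quot_clsD -!quot_clsM -quot_clsD mulrDl.
Qed.

Lemma quot_mulDr : right_distributive quot_mul +%R.
Proof.
move=> x y z; rewrite -[x]quot_reprK -[y]quot_reprK -[z]quot_reprK.
by rewrite -[X in quot_mul _ X = _]quot_clsD -!quot_clsM -quot_clsD mulrDr.
Qed.

Lemma quot_one_neq0 : quot_one != 0.
Proof.
apply/eqP => h; have /quot_clsP : quot_cls 1 = quot_cls 0.
  by rewrite -/quot_one h /quot_cls raddf0.
by rewrite subr0; exact/negP/ideal2_1.
Qed.

HB.instance Definition _ := GRing.Zmodule_isNzRing.Build quot_alg
  quot_mulA quot_mul1x quot_mulx1 quot_mulDl quot_mulDr quot_one_neq0.

Lemma quot_scaleA a b x : quot_scale a (quot_scale b x) = quot_scale (a * b) x.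
Proof. by rewrite -[x]quot_reprK -!quot_clsZ scalerA. Qed.

Lemma quot_scale1 : left_id 1 quot_scale.
Proof. by move=> x; rewrite -[x]quot_reprK -quot_clsZ scale1r. Qed.

Lemma quot_scaleDr : right_distributive quot_scale +%R.
Proof.
move=> a x y; rewrite -[x]quot_reprK -[y]quot_reprK -quot_clsD -!quot_clsZ.
by rewrite -quot_clsD scalerDr.
Qed.

Lemma quot_scaleDl x : {morph quot_scale^~ x : a b / a + b}.
Proof.
by move=> a b; rewrite -[x]quot_reprK -!quot_clsZ -quot_clsD scalerDl.
Qed.

HB.instance Definition _ := GRing.Zmodule_isLmodule.Build K quot_alg
  quot_scaleA quot_scale1 quot_scaleDr quot_scaleDl.

Let clsZ a x : a *: quot_cls x = quot_cls (a *: x).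
Proof. by rewrite quot_clsZ. Qed.
Let clsM x y : quot_cls x * quot_cls y = quot_cls (x * y).
Proof. by rewrite quot_clsM. Qed.

Lemma quot_scaleAl (a : K) (x y : quot_alg) : a *: (x * y) = a *: x * y.
Proof.
by rewrite -[x]quot_reprK -[y]quot_reprK clsM !clsZ clsM scalerAl.
Qed.
HB.instance Definition _ := GRing.Lmodule_isLalgebra.Build K quot_alg
  quot_scaleAl.

Lemma quot_scaleAr (a : K) (x y : quot_alg) : a *: (x * y) = x * (a *: y).
Proof.
by rewrite -[x]quot_reprK -[y]quot_reprK clsM !clsZ clsM scalerAr.
Qed.
HB.instance Definition _ := GRing.Lalgebra_isAlgebra.Build K quot_alg
  quot_scaleAr.

Lemma quot_cls_linear : linear quot_cls.
Proof. by move=> a x y; rewrite quot_clsD quot_clsZ. Qed.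
Lemma quot_cls_monoid_morphism : monoid_morphism quot_cls.
Proof. by split=> // x y; rewrite quot_clsM. Qed.
HB.instance Definition _ := GRing.isLinear.Build K A quot_alg _ quot_cls
  quot_cls_linear.
HB.instance Definition _ := GRing.isMonoidMorphism.Build A quot_alg quot_cls
  quot_cls_monoid_morphism.

End QuotientAlgebra.

(* ** The free algebra on a, b, c, d *)

Lemma malg_scalerAr (K : comNzRingType) (M : monomType) (k : K)
  (x y : {malg K[M]}) : k *: (x * y) = x * (k *: y).
Proof.
apply/malgP => w; rewrite mcoeffZ mcoeffMl.
rewrite (mcoeffMlw w (fsubset_refl (msupp x)) (msuppZ_le k y)).
rewrite mulr_sumr; apply: eq_bigr => u _.
rewrite mulr_sumr; apply: eq_bigr => v _.
by rewrite mcoeffZ mulrnAr mulrCA.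
Qed.

Inductive gen : predArgType := ga | gb | gc | gd.

Definition gen_code (g : gen) : nat :=
  match g with ga => 0 | gb => 1 | gc => 2 | gd => 3 end.
Definition gen_decode (n : nat) : option gen :=
  match n with
  | 0 => Some ga | 1 => Some gb | 2 => Some gc | 3 => Some gd | _ => None
  end.
Lemma gen_codeK : pcancel gen_code gen_decode.
Proof. by case. Qed.
HB.instance Definition _ := Countable.copy gen (pcan_type gen_codeK).

Definition gen_deg (g : gen) : int :=
  match g with ga | gc => -1 | gb | gd => 1 end.
Definition word_deg (w : {fmonom gen}) : int :=
  \sum_(g <- (w : seq gen)) gen_deg g.

Lemma word_degM (u v : {fmonom gen}) :
  word_deg (mmul u v) = word_deg u + word_deg v.
Proof. by rewrite /word_deg fmM big_cat. Qed.

Section FreeAlgebra.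
Variable K : comNzRingType.

Definition free_alg : Type := {malg K[{fmonom gen}]}.
HB.instance Definition _ := GRing.Lalgebra.on free_alg.
HB.instance Definition _ := GRing.Lalgebra_isAlgebra.Build K free_alg
  (@malg_scalerAr K {fmonom gen}).

Definition fgen (g : gen) : free_alg := mkmalgU (fmu g) 1.

Definition free_homog (k : int) (p : free_alg) : Prop :=
  forall w, w \in msupp p -> word_deg w = k.

Lemma free_homog0 k : free_homog k 0.
Proof. by move=> w; rewrite msupp0 inE. Qed.

Lemma free_homogP k a p p' :
  free_homog k p -> free_homog k p' -> free_homog k (a *: p + p').
Proof.
move=> hp hp' w /(fsubsetP (msuppD_le _ _)); rewrite inE => /orP[|/hp'//].
by move=> /(fsubsetP (msuppZ_le _ _)) /hp.
Qed.

Lemma free_homogM j k p p' :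
  free_homog j p -> free_homog k p' -> free_homog (j + k) (p * p').
Proof.
by move=> hp hp' w /msuppM_le[u [v [/hp <- /hp' <- ->]]]; exact: word_degM.
Qed.

Lemma free_homog_gen g : free_homog (gen_deg g) (fgen g).
Proof.
by move=> w; rewrite msuppU1 inE => /eqP ->; rewrite /word_deg fmU big_seq1.
Qed.

End FreeAlgebra.

(* ** The coordinate algebra C_q[SU_2] *)

Definition SU2_relators (K : fieldType) (A : algType K) (q : K)
    (a b c d : A) : seq A :=
  [:: a * b - q *: (b * a);
      a * c - q *: (c * a);
      b * d - q *: (d * b);
      c * d - q *: (d * c);
      b * c - c * b;
      a * d - d * a - (q - q^-1) *: (b * c);
      a * d - q *: (b * c) - 1].

Section QuantumSU2.
Variables (K : fieldType) (q : K).

Definition SU2_ideal_pred : {pred free_alg K} :=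
  gen_ideal (SU2_relators q (fgen K ga) (fgen K gb) (fgen K gc) (fgen K gd)).

(* The ideal is proper, as it is killed by the counit
   a, d |-> 1 and b, c |-> 0. *)
Definition counit_word (w : {fmonom gen}) : K :=
  (all (fun g => (g == ga) || (g == gd)) w)%:R.
Lemma counit_wordP : mmorphism counit_word.
Proof.
split=> [u v|]; last by rewrite /counit_word fm1.
by rewrite /counit_word fmM all_cat -mulnb natrM.
Qed.
HB.instance Definition _ :=
  isMultiplicative.Build {fmonom gen} K counit_word counit_wordP.

Definition counit (x : free_alg K) : K := mmap idfun counit_word x.
Lemma counit_zmod_morphism : zmod_morphism counit.
Proof. by move=> x y; exact: (raddfB (mmap idfun counit_word)). Qed.
Lemma counit_monoid_morphism : monoid_morphism counit.
Proof.
by split=> [|x y]; [exact: (rmorph1 (mmap idfun counit_word))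
                   | exact: (rmorphM (mmap idfun counit_word))].
Qed.
HB.instance Definition _ := GRing.isZmodMorphism.Build (free_alg K) K counit
  counit_zmod_morphism.
HB.instance Definition _ := GRing.isMonoidMorphism.Build (free_alg K) K counit
  counit_monoid_morphism.
Lemma counitZ k x : counit (k *: x) = k * counit x.
Proof. exact: mmapZ. Qed.

Lemma counit_gen g : counit (fgen K g) = ((g == ga) || (g == gd))%:R.
Proof.
by rewrite /counit /fgen mmapU /= mul1r /counit_word fmU /= andbT.
Qed.

Lemma relators_morph0 (A : algType K) (f : {rmorphism A -> K}) (a b c d : A) :
    (forall k x, f (k *: x) = k * f x) ->
    f a = 1 -> f b = 0 -> f c = 0 -> f d = 1 ->
  forall x, x \in SU2_relators q a b c d -> f x = 0.
Proof.
move=> fZ fa fb fc fd x; rewrite !inE.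
by do ?case/orP; move=> /eqP ->;
  rewrite !(rmorphB, rmorph1, fZ, rmorphM) /= ?fa ?fb ?fc ?fd;
  rewrite !(mulr0, mul0r, mulr1, subr0, subrr).
Qed.

Lemma SU2_ideal_1 : 1 \notin SU2_ideal_pred.
Proof.
apply/negP => /(gen_ideal_morph0 (f := counit)) h.
suff /eqP : counit 1 = 0 by rewrite rmorph1 oner_eq0.
apply: h; apply: relators_morph0; first exact: counitZ.
all: exact: counit_gen.
Qed.

Definition SU2_ideal : ideal2 (free_alg K) :=
  Ideal2 (gen_ideal_zmod_closed _) SU2_ideal_1
         (@gen_idealMl _ _) (@gen_idealMr _ _).

Definition Cq_SU2 : Type := quot_alg SU2_ideal.
HB.instance Definition _ := GRing.Algebra.on Cq_SU2.

Definition SU2_cls (p : free_alg K) : Cq_SU2 := quot_cls SU2_ideal p.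
HB.instance Definition _ := GRing.isLinear.Build K (free_alg K) Cq_SU2 _ SU2_cls
  (@quot_cls_linear K (free_alg K) SU2_ideal).
HB.instance Definition _ := GRing.isMonoidMorphism.Build (free_alg K) Cq_SU2
  SU2_cls (@quot_cls_monoid_morphism K (free_alg K) SU2_ideal).

(* The degree-k part of C_q[SU_2]: the span of the words of degree k. *)
Definition homog_pred (k : int) (x : Cq_SU2) : bool :=
  `[< exists2 p : free_alg K, free_homog k p & x = SU2_cls p >].
Arguments homog_pred _ _ /.
Definition homog (k : int) : {pred Cq_SU2} := homog_pred k.

Lemma homogP k x : reflect
  (exists2 p : free_alg K, free_homog k p & x = SU2_cls p) (x \in homog k).
Proof. exact: asboolP. Qed.

Lemma homog_submod_closed k : submod_closed (homog k).
Proof.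
split=> [|a x y /homogP[p hp ->] /homogP[p' hp' ->]]; apply/homogP.
  by exists 0; [exact: free_homog0 | rewrite raddf0].
by exists (a *: p + p'); [exact: free_homogP | rewrite linearP].
Qed.
HB.instance Definition _ k := GRing.isSubmodClosed.Build K Cq_SU2 (homog k)
  (homog_submod_closed k).

Lemma homogM j k l x y :
  j + k = l -> x \in homog j -> y \in homog k -> x * y \in homog l.
Proof.
move=> <- /homogP[p hp ->] /homogP[p' hp' ->]; apply/homogP.
by exists (p * p'); [exact: free_homogM | rewrite rmorphM].
Qed.

Record Epart (k : int) : predArgType :=
  EPart { Eval : Cq_SU2; Eval_homog : Eval \in homog k }.
HB.instance Definition _ k := [isSub for @Eval k].
HB.instance Definition _ k := [Choice of Epart k by <:].
HB.instance Definition _ k := [SubChoice_isSubLmodule of Epart k by <:].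

Definition Emul (j k l : int) (x : Epart j) (y : Epart k) (jkl : j + k = l) :
    Epart l :=
  EPart (homogM jkl (Eval_homog x) (Eval_homog y)).

Lemma homog1 : 1 \in homog 0.
Proof.
apply/homogP; exists 1; last by rewrite rmorph1.
by move=> w; rewrite msuppU1 inE => /eqP ->; rewrite /word_deg fm1 big_nil.
Qed.
Definition Eone : Epart 0 := EPart homog1.

End QuantumSU2.

(* ** The differential forms on the standard Podles sphere *)

Section PodlesForms.
Variables (R : realType) (q : R[i]).
Local Notation C := R[i].
Local Notation E := (Epart q).
Local Notation "x *_[ l ] y" := (Emul x y (erefl l%Z))
  (at level 40, left associativity, format "x  *_[ l ]  y").

(* The quadruple (m, (f, g), n) is the form m + f e^+ + g e^- + n tau. *)
Definition forms : Type := (E 0%Z * (E 2%Z * E (-2)%Z) * E 0%Z)%type.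
HB.instance Definition _ := GRing.Lmodule.on forms.

(* Degree zero elements act on e^+, e^- and tau centrally: on the left by left
   multiplication of coefficients, on the right by right multiplication. *)
Definition wedge (w w' : forms) : forms :=
  let: (m, (f, g), n) := w in
  let: (m', (f', g'), n') := w' in
  (m *_[0] m',
   (m *_[2] f' + f *_[2] m', m *_[-2] g' + g *_[-2] m'),
   m *_[0] n' + n *_[0] m' + f *_[0] g' - q ^+ 2 *: (g *_[0] f')).

Definition tau : forms := (0, (0, 0), Eone q).
(* kappa = - e^+ /\ e^-, where e^+ /\ e^- = tau. *)
Definition kappa : forms := - tau.

Definition lefschetz (w : forms) : forms := wedge w kappa.

Definition hodge (w : forms) : forms :=
  let: (m, (f, g), n) := w in (n, ('i *: f, - 'i *: g), m).
Definition hodge_inv (w : forms) : forms :=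
  let: (m, (f, g), n) := w in (n, (- 'i *: f, 'i *: g), m).

Lemma hodgeK : cancel hodge hodge_inv.
Proof.
move=> [[m [f g]] n] /=.
by rewrite !scalerA mulNr mulrN -expr2 sqrCi opprK !scale1r.
Qed.

Lemma hodge_invK : cancel hodge_inv hodge.
Proof.
move=> [[m [f g]] n] /=.
by rewrite !scalerA mulNr mulrN -expr2 sqrCi opprK !scale1r.
Qed.

Definition dual_lefschetz : forms -> forms := hodge_inv \o lefschetz \o hodge.

Definition form_proj (k : 'I_3) (w : forms) : forms :=
  let: (m, (f, g), n) := w in
  match val k with
  | 0 => (m, (0, 0), 0)
  | 1 => (0, (f, g), 0)
  | _ => (0, (0, 0), n)
  end.

Definition counting (w : forms) : forms :=
  \sum_(k < 3) ((k%:R - 1) : C) *: form_proj k w.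

End PodlesForms.

(* ** Representations of sl_2 *)

Section SL2.
Variable K : fieldType.

Definition traceless_pred (X : 'M[K]_2) : bool := \tr X == 0.
Arguments traceless_pred _ /.
Definition traceless : {pred 'M[K]_2} := traceless_pred.

Lemma traceless_submod_closed : submod_closed traceless.
Proof.
split=> [|a X Y /eqP hX /eqP hY]; first by rewrite unfold_in /= mxtrace0.
by rewrite unfold_in /= mxtraceD mxtraceZ hX hY mulr0 addr0.
Qed.
HB.instance Definition _ := GRing.isSubmodClosed.Build K 'M[K]_2 traceless
  traceless_submod_closed.

Record sl2 : predArgType :=
  Sl2 { sl2_mx : 'M[K]_2; sl2_mxP : sl2_mx \in traceless }.
HB.instance Definition _ := [isSub for sl2_mx].
HB.instance Definition _ := [Choice of sl2 by <:].
HB.instance Definition _ := [SubChoice_isSubLmodule of sl2 by <:].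

Lemma bracket_traceless (X Y : 'M[K]_2) : X *m Y - Y *m X \in traceless.
Proof. by rewrite unfold_in /= raddfB /= mxtrace_mulC subrr. Qed.
Definition sl2_bracket (X Y : sl2) : sl2 :=
  Sl2 (bracket_traceless (sl2_mx X) (sl2_mx Y)).

Lemma sl2_e_traceless : delta_mx 0 1 \in traceless.
Proof.
by rewrite unfold_in /= /mxtrace !big_ord_recl big_ord0 !mxE /= !addr0.
Qed.
Lemma sl2_f_traceless : delta_mx 1 0 \in traceless.
Proof.
by rewrite unfold_in /= /mxtrace !big_ord_recl big_ord0 !mxE /= !addr0.
Qed.
Lemma sl2_h_traceless : delta_mx 0 0 - delta_mx 1 1 \in traceless.
Proof.
rewrite unfold_in /= /mxtrace !big_ord_recl big_ord0 !mxE /=.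
by rewrite subr0 sub0r addr0 subrr.
Qed.

Definition sl2_e : sl2 := Sl2 sl2_e_traceless.
Definition sl2_f : sl2 := Sl2 sl2_f_traceless.
Definition sl2_h : sl2 := Sl2 sl2_h_traceless.

End SL2.

Definition op_commutator (V : zmodType) (A B : V -> V) : V -> V :=
  (A \o B) - (B \o A).

Definition sl2_representation (K : fieldType) (V : lmodType K)
    (rho : {linear sl2 K -> (V -> V)}) : Prop :=
  (forall X, linear (rho X)) /\
  (forall X Y, rho (sl2_bracket X Y) = op_commutator (rho X) (rho Y)).

(* Main.v *)
Require Import Defs.
From HB Require Import structures.
From mathcomp Require Import all_boot all_order all_algebra.
From mathcomp Require Import ring.
From mathcomp Require Import boolp functions reals.
From mathcomp Require Import complex.
Import GRing.Theory Num.Theory.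
Local Open Scope ring_scope.

(** Write a form as m + f e^+ + g e^- + n tau.  As kappa = - tau has top
    degree, wedging with it kills everything but m, and sends m to - m tau;
    conjugating by the Hodge map, which exchanges 1 and tau, gives the dual
    operator sending n tau to - n.  Hence the pair (m, n) carries a copy of the
    two-dimensional representation, with weights -1 on m and +1 on n, and the
    one-forms are killed by L, Lambda and H alike: they carry the trivial
    representation.  The coordinate formulas lefschetzE, dual_lefschetzE and
    countingE turn the three commutation relations into identities between
    multiples of m and n.

    That the relations yield a representation is a fact about any three linear
    operators e, f, h with [h, e] = 2 e, [h, f] = - 2 f and [e, f] = h.  A
    traceless matrix X is X_01 e + X_10 f + X_00 h in the standard basis of
    sl_2, so the representation can only be the map sl2_triple_map; it respects
    brackets because the commutator of linear operators is bilinear and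
    antisymmetric, which reduces the verification to the three relations
    (sl2_triple_map_bracket). *)

Set Implicit Arguments.
Unset Strict Implicit.

(** * Commutators of operators on a vector space *)

Section Commutator.
Variables (K : fieldType) (V : lmodType K).
Implicit Types A B C : V -> V.

Lemma op_commutatorE A B v : op_commutator A B v = A (B v) - B (A v).
Proof. by []. Qed.

Lemma op_commutatorAA A : op_commutator A A = 0.
Proof. by rewrite /op_commutator subrr. Qed.

Lemma op_commutatorC A B : op_commutator A B = - op_commutator B A.
Proof. by rewrite /op_commutator opprB. Qed.

(** Linearity of the fixed argument is what makes its composites with a
    pointwise sum split; the varying arguments can be any functions. *)
Lemma op_commutatorDr A B C : linear A ->
  op_commutator A (B + C) = op_commutator A B + op_commutator A C.
Proof.
move=> A_lin; apply: funext => v; rewrite !(op_commutatorE, fctE) /=.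
have -> : A (B v + C v) = A (B v) + A (C v).
  by have := A_lin 1 (B v) (C v); rewrite !scale1r.
by rewrite addrACA opprD.
Qed.

Lemma op_commutatorZr k A B : linear A ->
  op_commutator A (k *: B) = k *: op_commutator A B.
Proof.
move=> A_lin; apply: funext => v; rewrite !(op_commutatorE, fctE) /=.
have A0 : A 0 = 0.
  by have /esym/(canRL (addrK _)) := A_lin 1 0 0; rewrite !scale1r addr0 subrr.
by have := A_lin k (B v) 0; rewrite A0 !addr0 => ->; rewrite scalerBr.
Qed.

End Commutator.

(** * The representation defined by an sl_2-triple *)

Section Sl2Matrices.
Variable K : fieldType.
Implicit Types X Y : sl2 K.

Lemma sl2_mx11 X : sl2_mx X 1 1 = - sl2_mx X 0 0.
Proof.
have : \tr (sl2_mx X) == 0 by exact: sl2_mxP X.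
rewrite /mxtrace !big_ord_recl big_ord0 addr0 addrC addr_eq0 => /eqP.
by rewrite (_ : lift _ _ = 1) //; exact: val_inj.
Qed.

Lemma sl2_bracketE X Y i j : sl2_mx (sl2_bracket X Y) i j =
  sl2_mx X i 0 * sl2_mx Y 0 j + sl2_mx X i 1 * sl2_mx Y 1 j
    - (sl2_mx Y i 0 * sl2_mx X 0 j + sl2_mx Y i 1 * sl2_mx X 1 j).
Proof.
rewrite /= !mxE !big_ord_recl !big_ord0 !addr0.
by rewrite (_ : lift _ _ = 1) //; exact: val_inj.
Qed.

End Sl2Matrices.

Section Sl2Triple.
Variables (K : fieldType) (V : lmodType K) (e f h : V -> V).

(** The entries X_01, X_10 and X_00 are the coordinates of X in the basis
    sl2_e, sl2_f, sl2_h: the entry X_11 is determined by X_00. *)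
Definition sl2_triple_map (X : sl2 K) : V -> V :=
  sl2_mx X 0 1 *: e + sl2_mx X 1 0 *: f + sl2_mx X 0 0 *: h.

Lemma sl2_triple_map_linear : linear sl2_triple_map.
Proof.
move=> k X Y; rewrite /sl2_triple_map !mxE !scalerDr !scalerA !scalerDl.
by rewrite [RHS]addrACA; congr (_ + _); rewrite [RHS]addrACA.
Qed.

HB.instance Definition _ := GRing.isLinear.Build K (sl2 K) (V -> V) _
  sl2_triple_map sl2_triple_map_linear.

Lemma sl2_triple_map_e : sl2_triple_map (sl2_e K) = e.
Proof. by rewrite /sl2_triple_map !mxE /= scale1r !scale0r !addr0. Qed.

Lemma sl2_triple_map_f : sl2_triple_map (sl2_f K) = f.
Proof. by rewrite /sl2_triple_map !mxE /= scale1r !scale0r add0r addr0. Qed.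

Lemma sl2_triple_map_h : sl2_triple_map (sl2_h K) = h.
Proof. by rewrite /sl2_triple_map !mxE /= !subr0 scale1r !scale0r !add0r. Qed.

Hypotheses (e_lin : linear e) (f_lin : linear f) (h_lin : linear h).

Lemma linear_sl2_triple_map X : linear (sl2_triple_map X).
Proof.
move=> k u v; rewrite /sl2_triple_map !fctE /= e_lin f_lin h_lin !scalerDr.
rewrite !scalerA !(mulrC k) [RHS]addrACA; congr (_ + _).
by rewrite [RHS]addrACA.
Qed.

Hypotheses (he : op_commutator h e = 2 *: e)
  (hf : op_commutator h f = (- 2) *: f) (ef : op_commutator e f = h).

(** Expanding the commutator of the images of X and Y bilinearly leaves the
    commutators of e, f and h.  Collecting the coefficients of e, f and h gives
    the entries 01, 10 and 00 of the matrix commutator, once the entries 11 of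
    X and Y are eliminated by tracelessness. *)
Lemma sl2_triple_map_bracket X Y : sl2_triple_map (sl2_bracket X Y) =
  op_commutator (sl2_triple_map X) (sl2_triple_map Y).
Proof.
have X_lin := linear_sl2_triple_map X.
rewrite [in RHS]/sl2_triple_map -/(sl2_triple_map X).
rewrite !op_commutatorDr // !op_commutatorZr //.
(* The expansion is available in the right argument only: antisymmetry brings
   the image of X there. *)
rewrite ![op_commutator (sl2_triple_map X) _]op_commutatorC.
rewrite !op_commutatorDr // !op_commutatorZr // !op_commutatorAA he hf ef.
rewrite (op_commutatorC e h) (op_commutatorC f e) (op_commutatorC f h) he hf ef.
rewrite /sl2_triple_map !sl2_bracketE !sl2_mx11.
rewrite !(scaler0, oppr0, add0r, addr0, scalerDr, scalerN, scalerA).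
rewrite !(opprD, opprK) -!scaleNr.
(* The right-hand side now reads (h + e) + (h + f) + (e + f), up to
   coefficients: the two terms in each operator are brought together. *)
rewrite [X in _ = X + _]addrACA -[RHS]addrA.
rewrite [X in _ = _ + X]addrACA [RHS]addrC -!scalerDl.
by congr (_ *: _ + _ *: _ + _ *: _); ring.
Qed.

Lemma sl2_triple_map_representation : sl2_representation sl2_triple_map.
Proof.
by split=> [X|X Y]; [exact: linear_sl2_triple_map
                    |exact: sl2_triple_map_bracket].
Qed.

End Sl2Triple.

(** * The Lefschetz operators in coordinates *)

Section PodlesOperators.
Variables (R : realType) (q : R[i]).
Local Notation E := (Epart q).
Implicit Types (m n : E 0%Z) (f : E 2%Z) (g : E (-2)%Z).

Lemma EmulN1 m : Emul m (- Eone q) (erefl 0%Z) = - m.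
Proof. by apply: val_inj; rewrite /= mulrN1. Qed.

Lemma Emul0r j k l (x : E j) (jkl : j + k = l) : Emul x (0 : E k) jkl = 0.
Proof. by apply: val_inj; rewrite /= mulr0. Qed.

Lemma lefschetzE m f g n : lefschetz (m, (f, g), n) = (0, (0, 0), - m).
Proof.
rewrite /lefschetz /kappa /tau /= !oppr0 EmulN1 !Emul0r.
by rewrite !addr0 scaler0 subr0.
Qed.

Lemma dual_lefschetzE m f g n :
  dual_lefschetz (m, (f, g), n) = (- n, (0, 0), 0).
Proof.
transitivity (hodge_inv (lefschetz (n, ('i *: f, - 'i *: g), m))) => //.
by rewrite lefschetzE /= !scaler0.
Qed.

Lemma countingE m f g n : counting (m, (f, g), n) = (- m, (0, 0), n).
Proof.
rewrite /counting !big_ord_recl big_ord0 /form_proj /=.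
rewrite sub0r subrr scale0r add0r addr0 scaleN1r.
rewrite (_ : _ - 1 = 1 :> R[i]); last by rewrite /bump /=; ring.
by rewrite scale1r; congr (_, (_, _), _); rewrite /= ?(oppr0, add0r, addr0).
Qed.

Lemma lefschetz_linear : linear (@lefschetz R q).
Proof.
move=> k [[m [f g]] n] [[m' [f' g']] n']; rewrite !lefschetzE.
by congr (_, (_, _), _); rewrite /= ?scaler0 ?addr0 // opprD scalerN.
Qed.

Lemma dual_lefschetz_linear : linear (@dual_lefschetz R q).
Proof.
move=> k [[m [f g]] n] [[m' [f' g']] n']; rewrite !dual_lefschetzE.
by congr (_, (_, _), _); rewrite /= ?scaler0 ?addr0 // opprD scalerN.
Qed.

Lemma counting_linear : linear (@counting R q).
Proof.
move=> k [[m [f g]] n] [[m' [f' g']] n']; rewrite !countingE.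
by congr (_, (_, _), _); rewrite /= ?scaler0 ?addr0 // opprD scalerN.
Qed.

Lemma commutator_counting_lefschetz :
  op_commutator (@counting R q) (@lefschetz R q) = 2 *: @lefschetz R q.
Proof.
apply: funext => -[[m [f g]] n].
rewrite op_commutatorE fctE !(lefschetzE, countingE).
congr (_, (_, _), _); rewrite /= ?scaler0 ?subrr //.
  by rewrite oppr0 addr0.
by rewrite opprK scaler_nat mulr2n.
Qed.

Lemma commutator_counting_dual_lefschetz :
  op_commutator (@counting R q) (@dual_lefschetz R q)
    = - 2 *: @dual_lefschetz R q.
Proof.
apply: funext => -[[m [f g]] n].
rewrite op_commutatorE fctE !(dual_lefschetzE, countingE).
congr (_, (_, _), _); rewrite /= ?scaler0 ?subrr //.
by rewrite opprK scaleNr scalerN opprK scaler_nat mulr2n.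
Qed.

Lemma commutator_lefschetz_dual_lefschetz :
  op_commutator (@lefschetz R q) (@dual_lefschetz R q) = @counting R q.
Proof.
apply: funext => -[[m [f g]] n].
rewrite op_commutatorE !(dual_lefschetzE, lefschetzE, countingE).
by congr (_, (_, _), _); rewrite /= ?opprK ?subr0 ?sub0r.
Qed.

End PodlesOperators.

Theorem lemma4p2 (R : realType) (q : R[i]) (q_neq0 : q != 0) :
  let L := @lefschetz R q in
  let Lambda := @dual_lefschetz R q in
  let H := @counting R q in
  [/\ op_commutator H L = 2 *: L,
      op_commutator H Lambda = (- 2) *: Lambda,
      op_commutator L Lambda = H
    & exists rho : {linear sl2 R[i] -> (forms q -> forms q)},
        [/\ sl2_representation rho, rho (sl2_e _) = L,
            rho (sl2_f _) = Lambda & rho (sl2_h _) = H] ].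
Proof.
move=> L Lambda H.
have HL := commutator_counting_lefschetz q.
have HLambda := commutator_counting_dual_lefschetz q.
have LLambda := commutator_lefschetz_dual_lefschetz q.
split=> //; exists (sl2_triple_map L Lambda H); split.
- apply: sl2_triple_map_representation => //.
  + exact: lefschetz_linear.
  + exact: dual_lefschetz_linear.
  + exact: counting_linear.
- exact: sl2_triple_map_e.
- exact: sl2_triple_map_f.
- exact: sl2_triple_map_h.
Qed.
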